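(* Let $\bar{\Omega}\subset\mathbb{R}^n$ be a compact set which is the closure of its interior $\Omega$ and has smooth boundary, and let $Y=C^{\infty}(\bar{\Omega},\mathbb{R}^d)$, graded either by the $C^k$ norms or by the $H^k$ norms (see context; either choice may be used). Let $X=\bigcap_{k\ge0}X_k$ be a graded Fréchet space and let $F:X\to Y$. Let $k_0\ge 0$ be an integer and $R>0$. Assume that there are integers $d_1,d_2$ and sequences $m_k>0$, $m_k'>0$ ($k\in\mathbb{N}$) such that for all $x\in X$ with $\|x\|_{k_0}<R$: (1) $F(0)=0$; (2) $F$ is continuous and Gâteaux-differentiable, with derivative $DF(x)$; (3) for every $u\in X$ and every $k\ge0$, $\|DF(x)u\|_k\le m_k\|u\|_{k+d_1}$; (4) $DF(x)$ has a right-inverse $L(x)$: $DF(x)L(x)v=v$ for all $v\in Y$; (5) for every $v\in Y$ and every $k\ge 0$, $\|L(x)v\|_k\le m_k'\|v\|_{k+d_2}$. Then for every $y\in Y$ with $\|y\|_{k_0+d_2}<R/m'_{k_0}$ and every $m>m'_{k_0}$ there is some $x\in X$ such that $\|x\|_{k_0}<R$, $\|x\|_{k_0}\le m\|y\|_{k_0+d_2}$, and $F(x)=y$.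
   Context: A graded Fréchet space is a Fréchet space $X$ whose topology is defined by an increasing sequence of norms $\|\cdot\|_k$, $k\ge0$ (i.e. $\|x\|_k\le\|x\|_{k+1}$); $X_k$ denotes the completion of $X$ for $\|\cdot\|_k$, $X=\bigcap_k X_k$, and $x^j\to\bar x$ in $X$ iff $\|x^j-\bar x\|_k\to0$ for every $k$. On $C^\infty(\bar\Omega,\mathbb{R}^d)$ the $C^k$ norm is $\|x\|_k=\max_{p_1+\dots+p_n\le k}\max_{\omega\in\bar\Omega}|\partial^{p_1+\dots+p_n}x/\partial\omega_1^{p_1}\cdots\partial\omega_n^{p_n}(\omega)|$, and the $H^k$ norm is given by $\|x\|_k^2=\sum_{p_1+\dots+p_n\le k}\int_\Omega|\partial^{p_1+\dots+p_n}x/\partial\omega_1^{p_1}\cdots\partial\omega_n^{p_n}|^2d\omega$. Gâteaux-differentiability of $F$ at $x$ means there is a linear map $DF(x):X\to Y$ with $(F(x+tu)-F(x))/t\to DF(x)u$ in $Y$ as $t\to0$, for every $u\in X$. *)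

(* Defs.v *)
From HB Require Import structures.
From mathcomp Require Import all_boot all_order all_algebra.
From mathcomp Require Import all_classical all_reals all_analysis.
Set Implicit Arguments. Unset Strict Implicit. Unset Printing Implicit Defensive.
Import Order.TTheory GRing.Theory Num.Theory.
Import numFieldNormedType.Exports.
Local Open Scope classical_set_scope.
Local Open Scope ring_scope.

Section Defs.
Variable R : realType.

Definition ebasis (n : nat) (i : 'I_n) : 'rV[R]_n := \row_j (i == j)%:R.

Definition morder (n : nat) (p : 'I_n -> nat) : nat := (\sum_(i < n) p i)%N.

Definition pderiv (n : nat) (W : normedModType R) (p : 'I_n -> nat)
  (f : 'rV[R]_n -> W) : 'rV[R]_n -> W :=
  foldr (fun i g => iter (p i) (fun h => 'D_(ebasis i) h) g) f (enum 'I_n).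

Definition smooth_on (n : nat) (W : normedModType R) (U : set 'rV[R]_n)
  (f : 'rV[R]_n -> W) : Prop :=
  forall (p : 'I_n -> nat) (x : 'rV[R]_n), U x ->
    (forall i : 'I_n, derivable (pderiv p f) x (ebasis i)) /\
    {for x, continuous (pderiv p f)}.

Definition smooth_boundary (n : nat) (Om : set 'rV[R]_n) : Prop :=
  forall q, (closure Om `\` Om) q ->
    exists (U : set 'rV[R]_n) (phi : 'rV[R]_n -> R^o),
      [/\ open U, U q, smooth_on U phi,
          (forall z, U z -> exists i : 'I_n, 'D_(ebasis i) phi z != 0) &
          U `&` Om = U `&` [set z | phi z < 0]].

(* membership in C^infinity(closure Om, R^d): f is smooth on Om, continuous on
   closure Om, and every partial derivative extends continuously to closure Om.
   Elements of Y are identified when they agree on closure Om. *)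
Definition Cinf_closure (n d : nat) (Om : set 'rV[R]_n)
  (f : 'rV[R]_n -> 'rV[R]_d) : Prop :=
  [/\ smooth_on Om f, {within closure Om, continuous f} &
      forall p : 'I_n -> nat, exists g : 'rV[R]_n -> 'rV[R]_d,
        {within closure Om, continuous g} /\ {in Om, pderiv p f =1 g}].

Definition enorm (d : nat) (v : 'rV[R]_d) : R :=
  Num.sqrt (\sum_(j < d) v ord0 j ^+ 2).

(* C^k norm: max over |p| <= k and over closure Om of |d^p f|; since d^p f
   extends continuously to closure Om, this is the sup over Om *)
Definition Ck_norm (n d : nat) (Om : set 'rV[R]_n) (k : nat)
  (f : 'rV[R]_n -> 'rV[R]_d) : R :=
  sup [set r : R | exists (p : 'I_n -> nat) (w : 'rV[R]_n),
                     [/\ (morder p <= k)%N, Om w & r = enorm (pderiv p f w)]].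

(* Lebesgue integral over R^n, as the iterated integral over the coordinates
   (for the nonnegative integrands used below this is the Lebesgue integral
   on R^n, by Tonelli) *)
Fixpoint iter_int (m : nat) : ('rV[R]_m -> \bar R) -> \bar R :=
  match m with
  | 0 => fun g => g 0
  | m'.+1 => fun g =>
      (\int[@lebesgue_measure R]_(t in [set: R])
          iter_int (fun v : 'rV[R]_m' => g (row_mx (\row_(j < 1) t) v)))%E
  end.

Definition Hk_norm (n d : nat) (Om : set 'rV[R]_n) (k : nat)
  (f : 'rV[R]_n -> 'rV[R]_d) : R :=
  Num.sqrt (\sum_(p : {ffun 'I_n -> 'I_k.+1} | (morder (fun i => nat_of_ord (p i)) <= k)%N)
     fine (iter_int (fun w => ((\1_Om w : R) *
             enorm (pderiv (fun i => nat_of_ord (p i)) f w) ^+ 2)%:E))).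

Definition Ynorm (useH : bool) (n d : nat) (Om : set 'rV[R]_n) (k : nat)
  (f : 'rV[R]_n -> 'rV[R]_d) : R :=
  if useH then Hk_norm Om k f else Ck_norm Om k f.

Definition graded_frechet (X : lmodType R) (nX : nat -> X -> R) : Prop :=
  [/\ (forall k x, nX k x = 0 -> x = 0),
      (forall k x y, nX k (x + y) <= nX k x + nX k y),
      (forall k (a : R) x, nX k (a *: x) = `|a| * nX k x),
      (forall k x, nX k x <= nX k.+1 x) &
      (forall u : nat -> X,
         (forall k e, 0 < e -> exists N, forall i j, (N <= i)%N -> (N <= j)%N ->
                  nX k (u i - u j) < e) ->
         exists l : X, forall k, (fun i => nX k (u i - l)) @ \oo --> (0 : R))].

End Defs.

(* Main.v *)
(* If x(t) satisfies F(x(t)) = F(x0) + t v, its velocity can be taken to be L(x(t)) v,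
   whose norms are bounded by those of the fixed right-hand side v by (5). No such path
   need exist, but a polygonal one with slope error e, measured in the norms
   k <= K only, can be continued up to t = 1: being Lipschitz in every norm, it has a
   limit at each limit time, where the continuity of F preserves the error bound (a
   Brezis-Browder maximality argument). So F(x) = y can be solved from x0 up
   to an arbitrarily small error in finitely many norms, with
   |x - x0|_k <= m'_k |y - F(x0)|_{k+d2} for every k. Restarting from the approximate
   solution with K -> oo and summable errors gives a sequence that is Cauchy in
   every norm, whose limit is an exact solution. *)
Require Import Defs.
From HB Require Import structures.
From mathcomp Require Import all_boot all_order all_algebra.
From mathcomp Require Import all_classical all_reals all_analysis.
From mathcomp Require Import measurable_realfun ring lra.
Import Order.TTheory GRing.Theory Num.Theory.
Import numFieldNormedType.Exports.
Local Open Scope classical_set_scope.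
Local Open Scope ring_scope.

(** * A maximality principle for preorders *)

(** Each term of the sequence gains at least half of what [phi] can still gain above the previous
    one. The possible gain thus tends to 0 along the sequence, and nothing is left to gain above its
    upper bound. *)
Lemma brezis_browder (R : realType) (T : Type) (le : T -> T -> Prop)
    (phi : T -> R) (M : R) (z0 : T) :
  (forall z, le z z) ->
  (forall x y z, le x y -> le y z -> le x z) ->
  (forall x y, le x y -> phi x <= phi y) ->
  (forall z, le z0 z -> phi z <= M) ->
  (forall u : nat -> T, u 0%N = z0 -> (forall n, le (u n) (u n.+1)) ->
     exists z, forall n, le (u n) z) ->
  exists2 z, le z0 z & forall z', le z z' -> phi z' <= phi z.
Proof.
move=> le_refl le_tr phi_mono phi_le ub.
pose S z := [set phi z' | z' in [set z' | le z z']].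
have S_sup z : le z0 z -> has_sup (S z).
  move=> z0z; split; first by exists (phi z), z.
  by exists M => _ [z' zz' <-]; apply/phi_le/le_tr/zz'.
(* Away from the points above [z0], where [S z] may be unbounded, [z] itself is returned, so that
   the choice function is total. *)
have step z : exists z', le z z' /\ (le z0 z -> (phi z + sup (S z)) / 2 <= phi z').
  have [z0z|nz0z] := pselect (le z0 z); last by exists z; split.
  have [le_Sphi|lt_phiS] := leP (sup (S z)) (phi z).
    by exists z; split=> // _; lra.
  have e0 : 0 < (sup (S z) - phi z) / 2 by lra.
  have [_ [z' /= zz' <-] lt_z'] := sup_adherent e0 (S_sup z z0z).
  by exists z'; split=> // _; lra.
have [g gP] := choice step.
pose u n := iter n g z0.
have u_step n : le (u n) (u n.+1) by exact: (gP _).1.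
have [z uz] := ub u erefl u_step.
have z0u n : le z0 (u n) by elim: n => // n /le_tr; apply; exact: u_step.
exists z => [|z' zz']; first exact: (uz 0%N).
have phiu_mono : {homo (phi \o u) : n m / (n <= m)%N >-> n <= m}.
  apply: homo_leq => [x|y x w|n]; [exact: lexx|exact: le_trans|].
  exact/phi_mono/u_step.
have phiu_cvg : cvgn (phi \o u).
  apply: nondecreasing_is_cvgn => //.
  by exists (phi z) => _ [n _ <-]; exact/phi_mono/uz.
have lim_le : limn (phi \o u) <= phi z.
  by apply: limr_le => //; near=> n; exact/phi_mono/uz.
(* The half-gain rule reads [sup (S (u n)) <= 2 * phi (u n.+1) - phi (u n)]. *)
have key n : phi z' <= limn (phi \o u) *+ 2 - phi (u n).
  have S_ub : phi z' <= sup (S (u n)).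
    apply: sup_upper_bound; first exact: S_sup.
    by exists z' => //=; exact: le_tr (uz n) zz'.
  have := (gP (u n)).2 (z0u n).
  have := nondecreasing_cvgn_le phiu_mono phiu_cvg n.+1.
  by rewrite /= -/(u n); lra.
apply: le_trans lim_le.
have : limn (phi \o u) <= limn (phi \o u) *+ 2 - phi z'.
  by apply: limr_le => //; near=> n; have := key n; rewrite /=; lra.
lra.
Unshelve. all: by end_near. Qed.

(** * Approximate and exact solutions in graded spaces *)

Section GradedSpaces.
Variables (R : realType) (X V : lmodType R) (nX : nat -> X -> R).
(** The target carries seminorms only: functions that agree on [closure Om] will be identified, so a
    solution is expressed by [N k (F x - y) = 0]. *)
Variables (Y : set V) (N : nat -> V -> R).
Hypothesis X_frechet : graded_frechet nX.
Hypothesis Y_lin : forall (a : R) u v, Y u -> Y v -> Y (a *: u + v).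
Hypothesis N_ge0 : forall k v, 0 <= N k v.
Hypothesis N_triangle :
  forall k u v, Y u -> Y v -> N k (u + v) <= N k u + N k v.
Hypothesis N_scale : forall k (a : R) v, Y v -> N k (a *: v) = `|a| * N k v.
Variables (F : X -> V) (L : X -> V -> X) (k0 d2 : nat) (rad : R) (m' : nat -> R).
Hypothesis F_Y : forall x, Y (F x).
Hypothesis F_cont : forall x, nX k0 x < rad -> forall k (e : R), 0 < e ->
  exists k' (del : R), 0 < del /\
    forall x', nX k' (x' - x) < del -> N k (F x' - F x) < e.
(** Differentiability and the right inverse enter together: the derivative along [L x v] is already
    replaced by [v]. *)
Hypothesis F_diff : forall x, nX k0 x < rad -> forall v, Y v ->
  forall k, (fun t : R => N k (t^-1 *: (F (x + t *: L x v) - F x) - v)) @ 0^' -->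
    (0 : R).
Hypothesis m'_gt0 : forall k, 0 < m' k.
Hypothesis L_bound : forall x, nX k0 x < rad -> forall v, Y v ->
  forall k, nX k (L x v) <= m' k * N (k + d2)%N v.

Let nX_triangle k x y : nX k (x + y) <= nX k x + nX k y.
Proof. by case: X_frechet => _ h _ _ _; exact: h. Qed.

Let nX_scale k (a : R) x : nX k (a *: x) = `|a| * nX k x.
Proof. by case: X_frechet => _ _ h _ _; exact: h. Qed.

Let nX0 k : nX k 0 = 0.
Proof. by rewrite -(scale0r (0 : X)) nX_scale normr0 mul0r. Qed.

Let nXN k x : nX k (- x) = nX k x.
Proof. by rewrite -scaleN1r nX_scale normrN1 mul1r. Qed.

Let nX_ge0 k x : 0 <= nX k x.
Proof. by have := nX_triangle k x (- x); rewrite subrr nX0 nXN; lra. Qed.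

Let nX_split k x y z : nX k (z - x) <= nX k (y - x) + nX k (z - y).
Proof.
have -> : z - x = (y - x) + (z - y) by rewrite [RHS]addrC addrA subrK.
exact: nX_triangle.
Qed.

Let Y0 : Y 0.
Proof. by rewrite -(subrr (F 0)) -scaleN1r addrC; exact: Y_lin. Qed.

Let YZ (a : R) v : Y v -> Y (a *: v).
Proof. by move=> Yv; rewrite -[_ *: _]addr0; exact: Y_lin. Qed.

Let YD u v : Y u -> Y v -> Y (u + v).
Proof. by move=> Yu Yv; rewrite -[u]scale1r; exact: Y_lin. Qed.

Let YB u v : Y u -> Y v -> Y (u - v).
Proof. by move=> Yu Yv; apply: YD => //; rewrite -scaleN1r; exact: YZ. Qed.

Let N0 k : N k 0 = 0.
Proof. by rewrite -(scale0r (0 : V)) N_scale// normr0 mul0r. Qed.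

Let NN k v : Y v -> N k (- v) = N k v.
Proof. by move=> Yv; rewrite -scaleN1r N_scale// normrN1 mul1r. Qed.

Let near_of_lim (u : nat -> X) (l : X) :
  (forall k, (fun i => nX k (u i - l)) @ \oo --> (0 : R)) ->
  forall k e, 0 < e -> \forall i \near \oo, nX k (u i - l) < e.
Proof.
move=> ul k e e0.
have /cvgrPdist_lt/(_ e e0) := ul k; apply: filterS => i.
by rewrite sub0r normrN ger0_norm.
Qed.

Let NF_near (u : nat -> X) (l : X) : nX k0 l < rad ->
  (forall k, (fun i => nX k (u i - l)) @ \oo --> (0 : R)) ->
  forall k e, 0 < e -> \forall i \near \oo, N k (F (u i) - F l) < e.
Proof.
move=> lrad ul k e e0; have [k' [del [del0 Fdel]]] := F_cont l lrad k e e0.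
by have := near_of_lim u l ul k' del del0; apply: filterS => i; exact: Fdel.
Qed.

(** The admissible [t] depends on [k], so only finitely many norms are treated at once; this is the
    origin of the cutoff [K]. *)
Let gateaux x v K (e : R) : nX k0 x < rad -> Y v -> 0 < e ->
  \forall t \near (0 : R)^'+, forall k, (k <= K)%N ->
    N k (F (x + t *: L x v) - F x - t *: v) <= e * t.
Proof.
move=> xrad Yv e0.
have one k : \forall t \near (0 : R)^'+,
    N k (F (x + t *: L x v) - F x - t *: v) <= e * t.
  have Fd : (fun t : R => N k (t^-1 *: (F (x + t *: L x v) - F x) - v)) @ 0^'+ -->
      (0 : R).
    exact/cvg_dnbhs_at_right/F_diff.
  have /cvgrPdist_lt/(_ e e0) := Fd; apply: filter_app.
  near=> t; rewrite sub0r normrN ger0_norm// => /ltW Nt.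
  have t0 : 0 < t by [].
  have -> : F (x + t *: L x v) - F x - t *: v =
      t *: (t^-1 *: (F (x + t *: L x v) - F x) - v).
    by rewrite scalerBr scalerA divff ?scale1r ?gt_eqF.
  rewrite N_scale; last by apply: YB => //; apply: YZ; exact: YB.
  by rewrite gtr0_norm// mulrC ler_pM2r.
elim: K => [|K IH].
  by near=> t => k; rewrite leqn0 => /eqP ->; near: t; exact: one.
near=> t => k; rewrite leq_eqVlt => /orP[/eqP->|]; first by near: t; exact: one.
by move: k; near: t; exact: IH.
Unshelve. all: by end_near. Qed.

Let approximate_solution x0 v K (e : R) : Y v -> 0 < e ->
  nX k0 x0 + m' k0 * N (k0 + d2)%N v < rad ->
  exists x1, (forall k, nX k (x1 - x0) <= m' k * N (k + d2)%N v) /\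
    (forall k, (k <= K)%N -> N k (F x1 - F x0 - v) <= e).
Proof.
move=> Yv e0 x0rad.
(* [c k] bounds the speed of the path in the norm [k]. *)
pose c k := m' k * N (k + d2)%N v.
have c0 k : 0 <= c k by rewrite mulr_ge0// ltW.
(* A pair is a time and a position. The second clause is conditional so that [ler] is reflexive also
   at times beyond 1. *)
pose ler (p q : R * X) := [/\ p.1 <= q.1, p.1 <= 1 -> q.1 <= 1,
  forall k, nX k (q.2 - p.2) <= (q.1 - p.1) * c k &
  forall k, (k <= K)%N ->
    N k (F q.2 - F p.2 - (q.1 - p.1) *: v) <= e * (q.1 - p.1)].
have ler_refl p : ler p p.
  by split=> // k *; rewrite !subrr ?scale0r ?subr0 ?nX0 ?N0 ?mul0r ?mulr0.
have ler_tr p q r : ler p q -> ler q r -> ler p r.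
  move=> [pq1 pqt pqX pqN] [qr1 qrt qrX qrN]; split.
  - exact: le_trans qr1.
  - by move=> /pqt /qrt.
  - move=> k; apply: le_trans (nX_split k _ q.2 _) _.
    by have := pqX k; have := qrX k; lra.
  move=> k kK.
  have -> : F r.2 - F p.2 - (r.1 - p.1) *: v =
      (F q.2 - F p.2 - (q.1 - p.1) *: v) + (F r.2 - F q.2 - (r.1 - q.1) *: v).
    have -> : r.1 - p.1 = (q.1 - p.1) + (r.1 - q.1) by lra.
    rewrite scalerDl [RHS]addrACA -opprD; congr (_ - _).
    by rewrite [RHS]addrC addrA subrK.
  apply: le_trans (N_triangle _ _ _ _ _) _;
    [by apply: YB; [exact: YB|exact: YZ]..|].
  by have := pqN k kK; have := qrN k kK; lra.
pose z0 : R * X := (0, x0).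
have [|||z z0z zmax] :=
    @brezis_browder R (R * X)%type ler fst 1 z0 ler_refl ler_tr.
- by move=> p q [].
- by move=> p [_ + _ _]; apply; exact: ler01.
(* Upper bound of a chain: the times increase to [tl], and the Lipschitz bounds make the positions
   Cauchy in every norm. *)
- move=> u u0 u_step.
  have u_mono i j : (i <= j)%N -> ler (u i) (u j).
    by move: i j; apply: homo_leq => // q p r; exact: ler_tr.
  have u_le1 i : (u i).1 <= 1.
    by have [_ + _ _] := u_mono 0%N i isT; rewrite u0; apply; exact: ler01.
  have t_mono : {homo (fun i => (u i).1) : i j / (i <= j)%N >-> i <= j}.
    by move=> i j /u_mono[].
  have t_cvg : cvgn (fun i => (u i).1).
    by apply: nondecreasing_is_cvgn => //; exists 1 => _ [i _ <-].
  pose tl := limn (fun i => (u i).1).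
  have t_le i : (u i).1 <= tl by exact: nondecreasing_cvgn_le t_mono t_cvg i.
  have tl1 : tl <= 1 by apply: limr_le => //; exact: nearW.
  have t_near eta : 0 < eta -> \forall i \near \oo, tl - (u i).1 < eta.
    move=> eta0; have /cvgrPdist_lt/(_ eta eta0) := t_cvg.
    by apply: filterS => i /=; rewrite ger0_norm// subr_ge0.
  have [l ul] : exists l, forall k,
      (fun i => nX k ((u i).2 - l)) @ \oo --> (0 : R).
    case: X_frechet => _ _ _ _; apply => k eta eta0.
    (* The [+ 1] covers the case [c k = 0]. *)
    have eta'0 : 0 < eta / (c k + 1) by rewrite divr_gt0// ltr_wpDl.
    have [I _ hI] := t_near _ eta'0.
    have main i j : (I <= i)%N -> (i <= j)%N -> nX k ((u j).2 - (u i).2) < eta.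
      move=> Ii ij; have [_ _ + _] := u_mono i j ij => /(_ k)/le_lt_trans; apply.
      have := hI i Ii; rewrite /= ltr_pdivlMr ?ltr_wpDl//; apply: le_lt_trans.
      have := t_le j; have := t_le i; have := t_mono _ _ ij; have := c0 k.
      move=> ck uij ui uj.
      by apply: ler_pM; lra.
    exists I => i j Ii Ij; have [ij|/ltnW ji] := leqP i j.
      by rewrite -nXN opprB; exact: main.
    exact: main.
  have boundX k i : nX k (l - (u i).2) <= (tl - (u i).1) * c k.
    apply/ler_addgt0Pr => eta eta0.
    near \oo => j.
    have ij : (i <= j)%N by near: j; exact: nbhs_infty_ge.
    have h : nX k (l - (u j).2) < eta.
      by rewrite -nXN opprB; near: j; exact: near_of_lim.
    apply: le_trans (nX_split k _ (u j).2 _) _; apply: lerD; last exact: ltW.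
    have [_ _ /(_ k) + _] := u_mono i j ij => /le_trans; apply.
    by rewrite ler_wpM2r// lerD2r.
  (* Continuity of [F] is available only inside the ball, so [l] is located there before [F] is
     applied to the limit. *)
  have lrad : nX k0 l < rad.
    apply: le_lt_trans x0rad.
    have -> : l = x0 + (l - x0) by rewrite addrC subrK.
    apply: le_trans (nX_triangle _ _ _) _; rewrite lerD2l.
    have := boundX k0 0%N; rewrite u0 subr0 => /le_trans; apply.
    by rewrite ler_piMl.
  exists (tl, l) => i; split => //= k kK.
  apply/ler_addgt0Pr => eta eta0.
  have eta2 : 0 < eta / 2 by rewrite divr_gt0.
  have eta'0 : 0 < eta / 2 / (N k v + 1) by rewrite divr_gt0// ltr_wpDl.
  near \oo => j.
  have ij : (i <= j)%N by near: j; exact: nbhs_infty_ge.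
  have hF : N k (F (u j).2 - F l) < eta / 2 by near: j; exact: NF_near.
  have ht : tl - (u j).1 < eta / 2 / (N k v + 1) by near: j; exact: t_near.
  have [_ _ _ /(_ k kK) hj] := u_mono i j ij.
  (* The chain controls the way from [i] to [j]; from [j] to the limit, continuity of [F] and
     convergence of the times each cost at most [eta / 2]. *)
  have -> : F l - F (u i).2 - (tl - (u i).1) *: v =
      (F (u j).2 - F (u i).2 - ((u j).1 - (u i).1) *: v)
      - ((F (u j).2 - F l) + (tl - (u j).1) *: v).
    have -> : tl - (u i).1 = ((u j).1 - (u i).1) + (tl - (u j).1) by lra.
    rewrite scalerDl [in RHS]opprD opprB [RHS]addrACA -[in RHS]opprD.
    by congr (_ - _); rewrite [RHS]addrC addrA subrK.
  have YFj : Y (F (u j).2 - F l) by exact: YB.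
  have Ytj : Y ((tl - (u j).1) *: v) by exact: YZ.
  apply: le_trans (N_triangle _ _ _ _ _) _.
  + by apply: YB; [exact: YB|exact: YZ].
  + by rewrite -scaleN1r; apply: YZ; exact: YD.
  rewrite NN; last exact: YD.
  have := N_triangle k _ _ YFj Ytj; rewrite N_scale// ger0_norm ?subr_ge0//.
  move: ht; rewrite ltr_pdivlMr ?ltr_wpDl// => ht.
  have := t_le j; have := mulr_ge0 (ltW e0) (_ : 0 <= tl - (u j).1).
  by rewrite subr_ge0 => /(_ (t_le j)) /= ? ? ?; lra.
case: z z0z zmax => t x [/= t0 t1 xX xN] zmax.
have {}t1 : t <= 1 by apply: t1; exact: ler01.
have [t_lt1|t_ge1] := ltP t 1; last first.
  have t_eq1 : t = 1 by apply/le_anti; rewrite t1.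
  exists x; rewrite t_eq1 subr0 in xX xN; split => k.
    by have := xX k; rewrite mul1r.
  by move=> /xN; rewrite scale1r mulr1.
have xrad : nX k0 x < rad.
  apply: le_lt_trans x0rad; have -> : x = x0 + (x - x0) by rewrite addrC subrK.
  apply: le_trans (nX_triangle _ _ _) _; rewrite lerD2l.
  by apply: le_trans (xX k0) _; rewrite subr0 ler_piMl.
(* When [t < 1], a short segment in the direction [L x v] prolongs the path, against the maximality
   of [t]. *)
near (0 : R)^'+ => h.
have h0 : 0 < h by [].
have h1 : h < 1 - t by near: h; apply: nbhs_right_lt; rewrite subr_gt0.
have th : t + h - t = h by rewrite addrAC subrr add0r.
have xh : x + h *: L x v - x = h *: L x v by rewrite addrAC subrr add0r.
have : t + h <= t.
  apply: (zmax (t + h, x + h *: L x v)); split=> /=.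
  - by rewrite lerDl ltW.
  - by move=> _; lra.
  - move=> k; rewrite th xh nX_scale gtr0_norm//.
    by rewrite ler_pM2l//; exact: L_bound.
  by rewrite th; near: h; exact: gateaux.
by rewrite gerDl leNgt h0.
Unshelve. all: by end_near. Qed.

(** Each stage solves approximately for the current residual, with a tolerance halved every time.
    Since [N (k0 + d2) y] is positive, there is a margin between [m' k0 * Ny] and [mm * Ny] that
    absorbs all corrections after the first. *)
Lemma right_inverse_local_surjectivity (y : V) (mm : R) :
  (forall k, N k (F 0) = 0) -> Y y -> 0 < N (k0 + d2)%N y ->
  N (k0 + d2)%N y < rad / m' k0 -> m' k0 < mm ->
  exists x, [/\ nX k0 x < rad, nX k0 x <= mm * N (k0 + d2)%N y &
    forall k, N k (F x - y) = 0].
Proof.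
move=> NF0 Yy Ny0; rewrite ltr_pdivlMr// mulrC => Nyrad mm_gt.
set Ny := N (k0 + d2)%N y in Ny0 Nyrad *.
(* [del] is the total budget for the corrections: half the smaller of the margins left by [rad] and
   by [mm]. *)
have [del [del0 del_rad del_mm]] : exists del, [/\ 0 < del,
    m' k0 * Ny + del < rad & m' k0 * Ny + del <= mm * Ny].
  have a0 : 0 < rad - m' k0 * Ny by rewrite subr_gt0.
  have b0 : 0 < (mm - m' k0) * Ny by rewrite mulr_gt0// subr_gt0.
  have [ab|ba] := leP (rad - m' k0 * Ny) ((mm - m' k0) * Ny).
    by exists ((rad - m' k0 * Ny) / 2); split; lra.
  by exists ((mm - m' k0) * Ny / 2); split; lra.
pose h (j : nat) : R := 2^-1 ^+ j.
have h0 j : 0 < h j by rewrite exprn_gt0// invr_gt0.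
have hS j : h j.+1 = h j / 2 by rewrite /h exprS mulrC.
have h_cvg : h @ \oo --> (0 : R).
  by apply: cvg_expr; rewrite ger0_norm ?invr_ge0// invf_lt1// ltr1n.
have h_near c e : 0 <= c -> 0 < e -> \forall j \near \oo, c * h j < e.
  move=> c0 e0; have /cvgrPdist_lt/(_ (e / (c + 1))) := h_cvg.
  move=> /(_ (divr_gt0 e0 (ltr_wpDl c0 ltr01))); apply: filterS => j /=.
  rewrite sub0r normrN gtr0_norm// ltr_pdivlMr ?ltr_wpDl//.
  by have := h0 j; lra.
(* With this [eta], a residual of size [eta * h j] costs at most [del * h j] in the norm [k0]. *)
pose eta := del / m' k0.
have eta0 : 0 < eta by exact: divr_gt0.
have m'eta : m' k0 * eta = del by rewrite mulrC divfK// gt_eqF.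
pose res x := y - F x.
have Yres x : Y (res x) by exact: YB.
(* Stage [p.1] controls the residual up to the norm [k0 + d2 + p.1]: the norm [k0 + d2] is always
   included, as the next stage must stay in the ball, and every norm is reached eventually. *)
have step (p : nat * X) : exists x',
    nX k0 p.2 + m' k0 * N (k0 + d2)%N (res p.2) < rad ->
    (forall k, nX k (x' - p.2) <= m' k * N (k + d2)%N (res p.2)) /\
    (forall k, (k <= k0 + d2 + p.1)%N -> N k (res x') <= eta * h p.1.+1).
  have [prad|] := pselect (nX k0 p.2 + m' k0 * N (k0 + d2)%N (res p.2) < rad);
    last by move=> nprad; exists 0.
  have [x1 [x1X x1N]] := approximate_solution p.2 (res p.2) (k0 + d2 + p.1)%N
    (eta * h p.1.+1) (Yres _) (mulr_gt0 eta0 (h0 _)) prad.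
  exists x1 => _; split=> // k /x1N; rewrite /res opprB addrA subrK.
  by rewrite -NN ?opprB//; exact: YB.
have [g gP] := choice step.
pose u := fix u j : X := if j is j'.+1 then g (j', u j') else 0.
(* The term with the residual reserves room for the next step; [del * (1 - h j)] is the part of the
   budget committed so far, which is 0 at the start since [h 0 = 1]. *)
have u_inv j : nX k0 (u j) + m' k0 * N (k0 + d2)%N (res (u j)) <=
    m' k0 * Ny + del * (1 - h j).
  elim: j => [|j IH].
    rewrite nX0 add0r /h expr0 subrr mulr0 addr0 ler_pM2l//= /res.
    have := N_triangle (k0 + d2)%N y (- F 0) Yy; rewrite NN// NF0 addr0; apply.
    by rewrite -scaleN1r; exact: YZ.
  have [|gX gN] := gP (j, u j).
    by apply: le_lt_trans IH _; have := h0 j; nra.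
  have := gN (k0 + d2)%N (leq_addr _ _); rewrite /= -/(u j.+1) => resN.
  have := gX k0; rewrite /= => stepX.
  have := nX_split k0 0 (u j) (u j.+1); rewrite !subr0 => tri.
  have : m' k0 * N (k0 + d2)%N (res (u j.+1)) <= del * h j.+1.
    by rewrite -m'eta -mulrA ler_pM2l.
  by move: IH tri stepX; rewrite hS /=; lra.
have u_rad j : nX k0 (u j) + m' k0 * N (k0 + d2)%N (res (u j)) < rad.
  by apply: le_lt_trans (u_inv j) _; have := h0 j; nra.
have u_res k j : (k <= k0 + d2 + j)%N -> N k (res (u j.+1)) <= eta * h j.+1.
  by have [_ /(_ k)] := gP (j, u j) (u_rad j).
(* Step [j] needs the residual of [u j] in the norm [k + d2], which stage [j - 1] controls once
   [k < j]. *)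
have u_step k j : (k < j)%N -> nX k (u j.+1 - u j) <= m' k * eta * h j.
  case: j => // j kj.
  have [/(_ k)/= + _] := gP (j.+1, u j.+1) (u_rad j.+1).
  move=> /le_trans; apply; rewrite -mulrA ler_pM2l//; apply: u_res.
  by rewrite addnAC leq_add2r; apply: leq_trans (leq_addl _ _).
(* Telescoping: [h i + ... + h (j - 1) = 2 * (h i - h j)]. *)
have u_dist k i j : (k < i)%N -> (i <= j)%N ->
    nX k (u j - u i) <= m' k * eta * 2 * (h i - h j).
  move=> ki; elim: j => [|j IH].
    by rewrite leqn0 => /eqP ->; rewrite !subrr nX0 mulr0.
  rewrite leq_eqVlt => /orP[/eqP <-|]; first by rewrite !subrr nX0 mulr0.
  rewrite ltnS => ij; apply: le_trans (nX_split k _ (u j) _) _.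
  have := u_step k j (leq_trans ki ij); have := IH ij; rewrite hS.
  move: (m' k * eta) => c; lra.
have [l ul] : exists l, forall k,
    (fun i => nX k (u i - l)) @ \oo --> (0 : R).
  case: X_frechet => _ _ _ _; apply => k e e0.
  have c0 : 0 <= m' k * eta * 2 by apply: mulr_ge0 => //; apply: mulr_ge0; exact: ltW.
  have [I _ hI] := h_near _ _ c0 e0.
  have main i j : (I + k.+1 <= i)%N -> (i <= j)%N -> nX k (u j - u i) < e.
    move=> Ii ij; apply: le_lt_trans (u_dist k i j _ ij) _.
      by apply: leq_trans Ii; exact: leq_addl.
    apply: le_lt_trans (hI i _).
      by rewrite ler_wpM2l// gerBl ltW.
    by apply: leq_trans Ii; exact: leq_addr.
  exists (I + k.+1)%N => i j Ii Ij; have [ij|/ltnW ji] := leqP i j.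
    by rewrite -nXN opprB; exact: main.
  exact: main.
have l_le : nX k0 l <= m' k0 * Ny + del.
  apply/ler_addgt0Pr => e e0; near \oo => i.
  have hi : nX k0 (u i - l) < e by near: i; exact: near_of_lim.
  have := nX_split k0 0 (u i) l; rewrite !subr0 -(nXN k0 (l - _)) opprB.
  have := u_inv i; have := h0 i; have := N_ge0 (k0 + d2)%N (res (u i)).
  by have := m'_gt0 k0; nra.
have lrad : nX k0 l < rad by exact: le_lt_trans del_rad.
exists l; split=> //; first exact: le_trans del_mm.
(* In each fixed norm the residuals tend to 0 while [F (u i)] tends to [F l]. *)
move=> k; apply/le_anti; rewrite N_ge0 andbT.
apply/ler_addgt0Pr => e e0; rewrite add0r.
have e2 : 0 < e / 2 by rewrite divr_gt0.
near \oo => i.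
have hF : N k (F (u i) - F l) < e / 2 by near: i; exact: NF_near.
have hN : N k (res (u i)) <= eta * h i.
  have : (k < i)%N by near: i; exact: nbhs_infty_gt.
  case: (i) => // j kj; apply: u_res.
  exact: leq_trans (leq_addl _ _).
have he : eta * h i < e / 2 by near: i; apply: h_near; rewrite ?ltW.
have -> : F l - y = - (F (u i) - F l + res (u i)).
  by rewrite /res opprD !opprB addrA subrK.
rewrite NN; last by apply: YD => //; exact: YB.
apply: le_trans (N_triangle _ _ _ _ _) _ => //; first exact: YB.
lra.
Unshelve. all: by end_near. Qed.

End GradedSpaces.

(** * Sequential lower semicontinuity *)

Section LowerLimits.
Variable R : realType.
Local Open Scope ereal_scope.

Lemma ereal_between (x y : \bar R) : x < y -> exists a : R, x < a%:E < y.
Proof.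
case: x y => [x| |] [y| |] //=; rewrite ?lte_fin => xy.
- by exists ((x + y) / 2)%R; rewrite !lte_fin; apply/andP; split; lra.
- by exists (x + 1)%R; rewrite lte_fin ltrDl ltr01 ltry.
- by exists (y - 1)%R; rewrite ltNyr lte_fin gtrBl ltr01.
- by exists 0%R; rewrite ltNyr ltry.
Qed.

Lemma limn_einf_sup_einfs (u : (\bar R)^nat) :
  limn_einf u = ereal_sup (range (einfs u)).
Proof. by rewrite limn_einf_lim; apply/cvg_lim => //; exact: cvg_einfs_sup. Qed.

Lemma lt_limn_einf (u : (\bar R)^nat) (a : \bar R) :
  a < limn_einf u -> \forall n \near \oo, a < u n.
Proof.
rewrite limn_einf_sup_einfs => /ereal_sup_gt[_ [N _ <-]] aN.
exists N => // n /= Nn; apply: lt_le_trans aN _.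
by apply: ereal_inf_lbound; exists n.
Qed.

Lemma le_limn_einf (u : (\bar R)^nat) (l : \bar R) :
  (forall a : R, a%:E < l -> \forall n \near \oo, a%:E <= u n) ->
  l <= limn_einf u.
Proof.
move=> h; rewrite leNgt; apply/negP => /ereal_between[a /andP[ua al]].
have [N _ hN] := h a al.
move: ua; rewrite limn_einf_sup_einfs ltNge => /negP; apply.
apply: (@le_trans _ _ (einfs u N)); last by apply: ereal_sup_ubound; exists N.
by apply: le_ereal_inf_tmp => _ [n Nn <-]; exact: hN.
Qed.

(* Sequential lower semicontinuity is inherited by the iterated integrals below,
   by Fatou's lemma, and implies measurability; this replaces the Borel structure
   of [R^n] in the study of [iter_int]. *)
Definition seq_lsc (T : topologicalType) (f : T -> \bar R) :=
  forall (u : nat -> T) (x : T), u @ \oo --> x -> f x <= limn_einf (f \o u).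

Arguments seq_lsc {T} f.

(** Superlevel sets are open: otherwise points with values at most [a] converge to a point whose
    value exceeds [a]. *)
Lemma seq_lsc_measurable (f : R -> \bar R) : seq_lsc f -> measurable_fun setT f.
Proof.
move=> f_lsc; apply: lower_semicontinuous_measurable => x a afx.
apply: contrapT => nV.
have /choice[u uP] (n : nat) : exists y, ball x n.+1%:R^-1 y /\ f y <= a%:E.
  apply: contrapT => nex; apply: nV; exists (ball x n.+1%:R^-1).
    by apply: nbhsx_ballx; rewrite invr_gt0.
  by move=> y xy; rewrite ltNge; apply/negP => fya; apply: nex; exists y.
have ux : u @ \oo --> x.
  apply/cvg_ballP => e e0; near=> n.
  apply: le_ball (uP n).1; apply: ltW.
  by near: n; exact: near_infty_natSinv_lt (PosNum e0).
have /lt_limn_einf[N _ /(_ N (leqnn N))] := lt_le_trans afx (f_lsc u x ux).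
by rewrite /= ltNge (uP N).2.
Unshelve. all: by end_near. Qed.

(** Outside [U] the value 0 is minimal; at a point of [U], openness keeps the sequence eventually in
    [U], where [phi] is continuous. *)
Lemma indicator_seq_lsc (T : topologicalType) (U : set T) (phi : T -> R) :
  open U -> (forall x, 0 <= phi x)%R -> (forall x, U x -> {for x, continuous phi}) ->
  seq_lsc (fun x => ((\1_U x : R) * phi x)%:E).
Proof.
move=> oU phi0 phic u x ux.
have [Ux|nUx] := pselect (U x); last first.
  rewrite indicE memNset// mul0r; apply: le_limn_einf => a a0.
  by apply: nearW => n; apply: ltW; apply: lt_le_trans a0 _; rewrite lee_fin mulr_ge0.
suff /cvg_limn_einf_sup[-> _] :
  (fun x => ((\1_U x : R) * phi x)%:E) \o u @ \oo --> ((\1_U x : R) * phi x)%:E by [].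
have uU : \forall n \near \oo, U (u n) by exact/ux/open_nbhs_nbhs.
rewrite indicE mem_set// mul1r.
apply: (@cvg_trans _ ((EFin \o (phi \o u)) @ \oo)).
  apply: near_eq_cvg; near=> n; rewrite /= indicE mem_set ?mul1r//.
  by near: n.
apply: cvg_EFin; first exact: nearW.
by have := cvg_comp u phi ux (phic x Ux).
Unshelve. all: by end_near. Qed.

End LowerLimits.
Arguments seq_lsc {R T} f.

(** * Iterated integrals of lower semicontinuous functions *)

Section IteratedIntegral.
Variable R : realType.
Local Open Scope ereal_scope.

Definition slice m (t : R) (g : 'rV[R]_m.+1 -> \bar R) : 'rV[R]_m -> \bar R :=
  fun v => g (row_mx (\row_(j < 1) t) v).

Arguments slice {m} t g.

Lemma cvg_row_mx m (u : nat -> R) (t : R) (vs : nat -> 'rV[R]_m) (v : 'rV[R]_m) :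
  u @ \oo --> t -> vs @ \oo --> v ->
  (fun i => row_mx (\row_(j < 1) u i) (vs i) : 'rV[R]_m.+1) @ \oo -->
  (row_mx (\row_(j < 1) t) v : 'rV[R]_m.+1).
Proof.
move=> ut vsv; apply/cvg_ballP => e e0.
near=> i.
have ball_t : ball t e (u i) by near: i; exact: (cvg_ball ut).
have [_ ball_v] : ball v e (vs i) by near: i; exact: (cvg_ball vsv).
split=> // a b; rewrite !mxE.
by case: (splitP (b : 'I_(1 + m))) => k _; rewrite ?mxE.
Unshelve. all: by end_near. Qed.

Lemma iter_int_ge0 m (g : 'rV[R]_m -> \bar R) :
  (forall v, 0 <= g v) -> 0 <= iter_int g.
Proof.
elim: m g => [|m IH] g g0 /=; first exact: g0.
by apply: integral_ge0 => t _; apply: IH.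
Qed.

Lemma slice_seq_lsc m t (g : 'rV[R]_m.+1 -> \bar R) :
  seq_lsc g -> seq_lsc (slice t g).
Proof. by move=> gl u x ux; apply: gl; apply: cvg_row_mx => //; exact: cvg_cst. Qed.

(** Fatou's lemma with moving arguments [vs]. This strength lets the induction run: applied to the
    slices at [u i] tending to [t], it makes the inner integral lower semicontinuous in [t], hence
    measurable, as Fatou's lemma in the outer variable requires. *)
Lemma iter_int_liminf m (h : 'rV[R]_m -> \bar R) (hs : nat -> 'rV[R]_m -> \bar R) :
  (forall v, 0 <= h v) -> (forall i v, 0 <= hs i v) ->
  seq_lsc h -> (forall i, seq_lsc (hs i)) ->
  (forall vs v, vs @ \oo --> v -> h v <= limn_einf (fun i => hs i (vs i))) ->
  iter_int h <= limn_einf (fun i => iter_int (hs i)).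
Proof.
elim: m h hs => [|m IH] h hs h0 hs0 h_lsc hs_lsc h_hs /=.
  by apply: (h_hs (fun=> 0%R)); exact: cvg_cst.
have meas (g : 'rV[R]_m.+1 -> \bar R) : (forall v, 0 <= g v) -> seq_lsc g ->
    measurable_fun setT (fun t => iter_int (slice t g)).
  move=> g0 gl; apply: seq_lsc_measurable => u t ut.
  apply: (IH (slice t g) (fun i => slice (u i) g)) => [v|i v||i|vs v vsv];
    [exact: g0|exact: g0|exact: slice_seq_lsc|exact: slice_seq_lsc|].
  by apply: gl; exact: cvg_row_mx.
apply: le_trans; last first.
  by apply: fatou => [//|i|i t _]; [exact: meas|apply: iter_int_ge0 => v; exact: hs0].
have le_slice t :
    iter_int (slice t h) <= limn_einf (fun i => iter_int (slice t (hs i))).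
  apply: (IH (slice t h) (fun i => slice t (hs i))) => [v|i v||i|vs v vsv];
    [exact: h0|exact: hs0|exact: slice_seq_lsc|exact: slice_seq_lsc|].
  by apply: h_hs; apply: cvg_row_mx => //; exact: cvg_cst.
apply: ge0_le_integral => // [t _|||t _].
- by apply: iter_int_ge0 => v; exact: h0.
- exact: meas.
- apply: measurableT_comp => //.
  apply: (measurable_fun_limn_esup (f := fun i t => - iter_int (slice t (hs i)))).
  by move=> i; apply: measurableT_comp => //; exact: meas.
- exact: le_slice.
Qed.

Lemma iter_int_slice_measurable m (g : 'rV[R]_m.+1 -> \bar R) :
  (forall v, 0 <= g v) -> seq_lsc g ->
  measurable_fun setT (fun t => iter_int (slice t g)).
Proof.
move=> g0 gl; apply: seq_lsc_measurable => u t ut.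
apply: (@iter_int_liminf m (slice t g) (fun i => slice (u i) g)) =>
  [v|i v||i|vs v vsv];
  [exact: g0|exact: g0|exact: slice_seq_lsc|exact: slice_seq_lsc|].
by apply: gl; exact: cvg_row_mx.
Qed.

Lemma le_iter_int m (g h : 'rV[R]_m -> \bar R) :
  (forall v, 0 <= g v) -> seq_lsc g -> (forall v, 0 <= h v) -> seq_lsc h ->
  (forall v, g v <= h v) -> iter_int g <= iter_int h.
Proof.
elim: m g h => [|m IH] g h g0 gl h0 hl gh /=; first exact: gh.
apply: ge0_le_integral => // [t _|||t _].
- by apply: iter_int_ge0 => v; exact: g0.
- exact: iter_int_slice_measurable.
- exact: iter_int_slice_measurable.
- by apply: IH => [v||v||v]; rewrite ?g0 ?h0 ?gh//; exact: slice_seq_lsc.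
Qed.

Lemma iter_intD m (g h : 'rV[R]_m -> \bar R) :
  (forall v, 0 <= g v) -> seq_lsc g -> (forall v, 0 <= h v) -> seq_lsc h ->
  iter_int (fun v => g v + h v) = iter_int g + iter_int h.
Proof.
elim: m g h => [//|m IH] g h g0 gl h0 hl /=.
rewrite -ge0_integralD//.
- apply: eq_integral => t _; apply: IH => [v||v|]; rewrite ?g0 ?h0//;
    exact: slice_seq_lsc.
- by move=> t _; apply: iter_int_ge0 => v; exact: g0.
- exact: iter_int_slice_measurable.
- by move=> t _; apply: iter_int_ge0 => v; exact: h0.
- exact: iter_int_slice_measurable.
Qed.

Lemma iter_intZ m (c : R) (g : 'rV[R]_m -> \bar R) : (0 <= c)%R ->
  (forall v, 0 <= g v) -> seq_lsc g ->
  iter_int (fun v => c%:E * g v) = c%:E * iter_int g.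
Proof.
move=> c0; elim: m g => [//|m IH] g g0 gl /=.
rewrite -ge0_integralZl_EFin//.
- apply: eq_integral => t _; apply: IH => [v|]; rewrite ?g0//; exact: slice_seq_lsc.
- by move=> t _; apply: iter_int_ge0 => v; exact: g0.
- exact: iter_int_slice_measurable.
Qed.

(** Balls of row vectors are cubes, so the indicator splits over the coordinates. The factor [M] is
    arbitrary so that the induction can absorb the indicator of the first coordinate into it. *)
Lemma iter_int_ball m (c : 'rV[R]_m) (r M : R) : (0 < r)%R -> (0 <= M)%R ->
  iter_int (fun w => ((\1_(ball c r) w : R) * M)%:E) = (M * (r *+ 2) ^+ m)%:E.
Proof.
move=> r0; elim: m c M => [|m IH] c M M0 /=.
  by rewrite indicE mem_set ?mul1r ?expr0 ?mulr1//; split=> // i [].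
pose t0 := c ord0 ord0; pose c' := \row_(j < m) c ord0 (lift ord0 j).
have ballE t v : ((\1_(ball c r) (row_mx (\row_(j < 1) t) v : 'rV[R]_m.+1) : R) =
    \1_(ball t0 r) t * \1_(ball c' r) v)%R.
  rewrite !indicE -natrM mulnb; congr (_%:R); congr nat_of_bool.
  apply/idP/andP => [/set_mem[_ h]|[/set_mem ht /set_mem[_ hv]]].
    split; apply/mem_set; first by have := h ord0 ord0; rewrite mxE;
      case: splitP => // k _; rewrite mxE.
    split=> // i j; have := h i (lift ord0 j); rewrite !mxE (ord1 i).
    have -> : lift ord0 j = rshift 1 j by apply/val_inj.
    by case: splitP => k /= e; [move: (ltn_ord k); rewrite -e|
       have -> // : k = j; apply/val_inj; case: e].
  apply/mem_set; split=> // i j; rewrite mxE (ord1 i).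
  case: (splitP (j : 'I_(1 + m))) => k e.
    by rewrite mxE (_ : j = ord0)//; apply/val_inj; rewrite /= e (ord1 k).
  have := hv ord0 k; rewrite mxE (_ : lift ord0 k = j)//.
  by apply/val_inj; rewrite /= e.
under eq_integral => t _.
  under [X in iter_int X]eq_fun => v do rewrite ballE mulrAC mulrC.
  rewrite IH; last by rewrite mulr_ge0.
  rewrite -mulrA EFinM muleC.
  over.
rewrite ge0_integralZl_EFin//=.
- rewrite integral_indic//; last exact: measurable_ball.
  rewrite setIT.
  rewrite [X in _ * X](_ : _ = (r *+ 2)%:E).
    by rewrite -EFinM exprS mulrCA mulrC.
  by apply: lebesgue_measure_ball; exact: ltW.
- by apply/measurable_EFinP; exact: measurable_indic (measurable_ball _ _).
- by rewrite mulr_ge0// exprn_ge0// mulrn_wge0// ltW.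
Qed.

End IteratedIntegral.

(** * Linearity and locality of iterated partial derivatives *)

Section PartialDerivatives.
Variables (R : realType) (n : nat) (W : normedModType R) (U : set 'rV[R]_n).
Hypothesis U_open : open U.
Implicit Types (f g : 'rV[R]_n -> W) (p : 'I_n -> nat) (s : seq 'I_n).

(** The intermediate stages of [pderiv], where only the coordinates in [s] have been treated. *)
Definition pderiv_seq s p f : 'rV[R]_n -> W :=
  foldr (fun i h => iter (p i) (fun h => 'D_(ebasis R i) h) h) f s.

Lemma pderiv_seq_cat s1 s2 p p' f :
  {in s1, forall i, p' i = 0%N} -> {in s2, forall i, p' i = p i} ->
  pderiv_seq (s1 ++ s2) p' f = pderiv_seq s2 p f.
Proof.
move=> p0 pp'; rewrite /pderiv_seq foldr_cat.
have -> : foldr (fun i h => iter (p' i) (fun h => 'D_(ebasis R i) h) h) f s2 =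
    pderiv_seq s2 p f.
  elim: s2 pp' => //= i s2 IH pp'; rewrite pp' ?mem_head// IH// => j js.
  by apply: pp'; rewrite inE js orbT.
elim: s1 p0 => //= i s1 IH p0; rewrite p0 ?mem_head//= IH// => j js.
by apply: p0; rewrite inE js orbT.
Qed.

Lemma pderiv0 f : pderiv (fun=> 0%N) f = f.
Proof.
rewrite -[LHS]/(pderiv_seq (enum 'I_n) _ f) -(cats0 (enum 'I_n)).
by rewrite (@pderiv_seq_cat _ _ (fun=> 0%N)).
Qed.

(** An intermediate stage is itself a full [pderiv], for a multi-index that vanishes on the
    coordinates not yet reached, so smoothness applies to it. *)
Lemma smooth_on_pderiv_seq f s1 i s2 p (q : nat) x (j : 'I_n) :
  smooth_on U f -> enum 'I_n = s1 ++ i :: s2 -> U x ->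
  derivable (iter q (fun h => 'D_(ebasis R i) h) (pderiv_seq s2 p f)) x (ebasis R j).
Proof.
move=> f_smooth enumE Ux.
have := enum_uniq 'I_n; rewrite enumE cat_uniq /= => /and3P[_ s1_dis /andP[is2 _]].
pose p' k := if k == i then q else if k \in s2 then p k else 0%N.
have [+ _] := f_smooth p' x Ux => /(_ j); congr (derivable _ _ _).
rewrite -[LHS]/(pderiv_seq (enum 'I_n) p' f) enumE.
pose p'' k := if k == i then q else p k.
rewrite (@pderiv_seq_cat _ _ p'').
- rewrite /= /p'' eqxx; congr (iter q _ _).
  apply: (@pderiv_seq_cat [::]) => // k; case: eqP => [->|//].
  by rewrite (negbTE is2).
- move=> k ks1; rewrite /p'.
  have /norP[kni /negbTE->] : ~~ ((k == i) || (k \in s2)).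
    move: s1_dis; apply: contra => ks; apply/orP.
    by case/orP: ks => [/eqP <-|ks2]; [left|right; apply/hasP; exists k].
  by rewrite (negbTE kni).
- move=> k; rewrite inE /p' /p''.
  by case: eqP => //= _ ->.
Qed.

Lemma near_open (P : 'rV[R]_n -> Prop) x : U x -> (forall z, U z -> P z) ->
  \forall z \near x, P z.
Proof. by move=> Ux UP; apply: filterS UP _; exact: open_nbhs_nbhs. Qed.

Lemma eq_pderiv p f g : (forall x, U x -> f x = g x) ->
  forall x, U x -> pderiv p f x = pderiv p g x.
Proof.
move=> fg; rewrite -![pderiv p _]/(pderiv_seq (enum 'I_n) p _).
elim: (enum 'I_n) => //= i s IH; elim: (p i) => //= q IHq x Ux.
by apply: near_eq_derive; exact: near_open IHq.
Qed.

Lemma pderiv_linear p f g (a : R) : smooth_on U f -> smooth_on U g ->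
  forall x, U x ->
  pderiv p (fun w => a *: f w + g w) x = a *: pderiv p f x + pderiv p g x.
Proof.
move=> f_smooth g_smooth.
rewrite -![pderiv p _]/(pderiv_seq (enum 'I_n) p _).
have : enum 'I_n = [::] ++ enum 'I_n by [].
(* The induction is on a suffix of the enumeration; the remembered prefix is what gives
   differentiability at each stage. *)
elim: {2 3 4 5}(enum 'I_n) [::] => // i s IH s1 enumE.
have {}IH := IH (rcons s1 i); rewrite cat_rcons in IH; have {}IH := IH enumE.
rewrite /=; elim: (p i) => //= q IHq x Ux.
have df := smooth_on_pderiv_seq f s1 i s p q x i f_smooth enumE Ux.
have dg := smooth_on_pderiv_seq g s1 i s p q x i g_smooth enumE Ux.
have -> := near_eq_derive (ebasis R i) (near_open _ x Ux IHq).
by rewrite -deriveZ// -deriveD//; exact: derivableZ.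
Qed.

Lemma smooth_on_linear f g (a : R) : smooth_on U f -> smooth_on U g ->
  smooth_on U (fun w => a *: f w + g w).
Proof.
move=> f_smooth g_smooth p x Ux.
have lin z : U z -> a *: pderiv p f z + pderiv p g z =
    pderiv p (fun w => a *: f w + g w) z by move=> Uz; rewrite pderiv_linear.
have near_lin := near_open _ x Ux lin.
have [df cf] := f_smooth p x Ux; have [dg cg] := g_smooth p x Ux; split.
  move=> i; apply: (near_eq_derivable near_lin).
  by apply: derivableD => //; exact: derivableZ.
suff : pderiv p (fun w => a *: f w + g w) @ x -->
    a *: pderiv p f x + pderiv p g x by rewrite lin.
apply: cvg_trans (near_eq_cvg near_lin) _.
by apply: cvgD; [apply: cvgZ; [exact: cvg_cst|exact: cf]|exact: cg].
Qed.

End PartialDerivatives.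
Arguments pderiv0 {R n W} f.

(** * Triangle inequalities from weighted squares *)

Section EuclideanNorm.
Variable R : realType.

(* The optimal choice is [c = sqrt B / sqrt A]; shifting both roots by a positive
   quantity covers the degenerate cases. *)
Lemma sqrt_le_add (A B Q : R) : 0 <= A -> 0 <= B ->
  (forall c, 0 < c -> Q <= (1 + c) * A + (1 + c^-1) * B) ->
  Num.sqrt Q <= Num.sqrt A + Num.sqrt B.
Proof.
move=> A0 B0 hQ; apply/ler_addgt0Pr => e e0.
set a := Num.sqrt A; set b := Num.sqrt B.
have a0 : 0 <= a by exact: sqrtr_ge0.
have b0 : 0 <= b by exact: sqrtr_ge0.
have a'0 : 0 < a + e / 2 by lra.
have b'0 : 0 < b + e / 2 by lra.
have c0 : 0 < (b + e / 2) / (a + e / 2) by exact: divr_gt0.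
have := hQ _ c0; rewrite invf_div => hQc.
have AE : A <= (a + e / 2) ^+ 2.
  by rewrite -[A]sqr_sqrtr// ler_sqr ?nnegrE; rewrite -/a; lra.
have BE : B <= (b + e / 2) ^+ 2.
  by rewrite -[B]sqr_sqrtr// ler_sqr ?nnegrE; rewrite -/b; lra.
have -> : a + b + e = Num.sqrt ((a + b + e) ^+ 2).
  by rewrite sqrtr_sqr ger0_norm//; lra.
apply: ler_wsqrtr; apply: (le_trans hQc).
apply: (@le_trans _ _ ((1 + (b + e / 2) / (a + e / 2)) * (a + e / 2) ^+ 2 +
    (1 + (a + e / 2) / (b + e / 2)) * (b + e / 2) ^+ 2)).
  by apply: lerD; apply: ler_wpM2l => //; rewrite addr_ge0// divr_ge0// ltW.
rewrite le_eqVlt; apply/orP; left; apply/eqP.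
by field; apply/andP; split; apply: lt0r_neq0; lra.
Qed.

Variable d : nat.
Implicit Types u v : 'rV[R]_d.

Lemma enorm_ge0 v : 0 <= enorm v. Proof. exact: sqrtr_ge0. Qed.

Lemma sqr_enorm v : enorm v ^+ 2 = \sum_(j < d) v ord0 j ^+ 2.
Proof. by rewrite sqr_sqrtr// sumr_ge0// => j _; exact: sqr_ge0. Qed.

Lemma enormZ (a : R) v : enorm (a *: v) = `|a| * enorm v.
Proof.
rewrite /enorm -sqrtr_sqr -sqrtrM ?sqr_ge0// mulr_sumr; congr Num.sqrt.
by apply: eq_bigr => j _; rewrite mxE exprMn.
Qed.

Lemma enorm0_eq0 v : enorm v = 0 -> v = 0.
Proof.
move=> v0; have := sqr_enorm v; rewrite v0 expr0n /= => /esym/eqP.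
rewrite psumr_eq0 => [/allP h|j _]; last exact: sqr_ge0.
apply/rowP => j; rewrite mxE; apply/eqP; rewrite -sqrf_eq0.
by apply: h; rewrite mem_index_enum.
Qed.

(** In each coordinate the defect is the square [c^-1 * (c * a - b) ^+ 2]. Unlike the triangle
    inequality, this form can be integrated and summed directly. *)
Lemma sqr_enormD_le u v (c : R) : 0 < c ->
  enorm (u + v) ^+ 2 <= (1 + c) * enorm u ^+ 2 + (1 + c^-1) * enorm v ^+ 2.
Proof.
move=> c0; rewrite !sqr_enorm !mulr_sumr -big_split /=; apply: ler_sum => j _.
rewrite mxE; set a := u _ _; set b := v _ _.
have : 0 <= c^-1 * (c * a - b) ^+ 2.
  by apply: mulr_ge0; [rewrite invr_ge0 ltW|exact: sqr_ge0].
have -> : c^-1 * (c * a - b) ^+ 2 = c * a ^+ 2 - 2 * (a * b) + c^-1 * b ^+ 2.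
  by field; rewrite gt_eqF.
by rewrite sqrrD mulr2n; lra.
Qed.

Lemma enormD u v : enorm (u + v) <= enorm u + enorm v.
Proof.
have sq_sqrt (w : 'rV[R]_d) : enorm w = Num.sqrt (enorm w ^+ 2).
  by rewrite sqrtr_sqr; apply/esym/ger0_norm/enorm_ge0.
rewrite [leLHS]sq_sqrt [in leRHS](sq_sqrt u) [in leRHS](sq_sqrt v).
by apply: sqrt_le_add => [||c]; rewrite ?sqr_ge0//; exact: sqr_enormD_le.
Qed.

Lemma sqr_enorm_continuous : continuous (fun v : 'rV[R]_d => enorm v ^+ 2).
Proof.
move=> v; rewrite (_ : (fun v => _) = fun v : 'rV[R]_d => \sum_(j < d) v ord0 j ^+ 2);
  last by apply/funext => w; exact: sqr_enorm.
apply: (@cvg_big _ _ _ _ _ _ _ (nbhs v)) => [|j _]; first exact: add_continuous.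
have vj : (fun w : 'rV[R]_d => w ord0 j) @ v --> v ord0 j by exact: coord_continuous.
by rewrite expr2; apply: cvgM.
Qed.

Lemma sqr_enorm_le v : enorm v ^+ 2 <= d%:R * `|v| ^+ 2.
Proof.
rewrite sqr_enorm; apply: (@le_trans _ _ (\sum_(j < d) `|v| ^+ 2)); last first.
  by rewrite sumr_const card_ord mulr_natl.
apply: ler_sum => j _; rewrite -[leLHS]ger0_norm ?sqr_ge0// normrX.
rewrite lerXn2r ?nnegrE//.
rewrite [leRHS]mx_normrE.
exact: (le_bigmax _ (fun i : 'I_1 * 'I_d => `|v i.1 i.2|) (ord0, j)).
Qed.

End EuclideanNorm.

(** * The gradings of the space of smooth functions *)

Section FunctionSpace.
Variables (R : realType) (n d : nat) (Om : set 'rV[R]_n).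
Hypotheses (Om_open : open Om) (Om_compact : compact (closure Om)).
Implicit Types (f g : 'rV[R]_n -> 'rV[R]_d) (p : 'I_n -> nat).
Local Notation Cinf := (@Cinf_closure R n d Om).

Lemma Cinf_linear f g (a : R) : Cinf f -> Cinf g ->
  Cinf (fun w => a *: f w + g w).
Proof.
have lin_within (u v : 'rV[R]_n -> 'rV[R]_d) :
    {within closure Om, continuous u} -> {within closure Om, continuous v} ->
    {within closure Om, continuous (fun w => a *: u w + v w)}.
  move=> uc vc; apply: within_continuousD => // w.
  by apply: cvgZ; [exact: cvg_cst|exact: uc].
case=> f_smooth fc fp [g_smooth gc gp]; split.
- exact: smooth_on_linear.
- exact: lin_within.
- move=> p; have [u [uc uE]] := fp p; have [v [vc vE]] := gp p.
  exists (fun w => a *: u w + v w); split; first exact: lin_within.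
  move=> w Omw; rewrite (pderiv_linear _ _ _ Om Om_open)//; last exact/set_mem.
  by rewrite uE// vE.
Qed.

(** The continuous extension of the derivative is bounded on the compact closure. *)
Lemma Cinf_pderiv_bounded f p : Cinf f ->
  exists2 M, 0 <= M & forall w, Om w -> enorm (pderiv p f w) ^+ 2 <= M.
Proof.
case=> _ _ /(_ p)[g [gc gE]].
have [M [_ hM]] := compact_bounded (continuous_compact gc Om_compact).
exists (d%:R * (`|M| + 1) ^+ 2); first by rewrite mulr_ge0// sqr_ge0.
move=> w Omw; rewrite gE ?mem_set//; apply: (le_trans (sqr_enorm_le _ _ _)).
rewrite ler_wpM2l// lerXn2r ?nnegrE//.
apply: hM; last by exists w => //; exact: subset_closure.
by rewrite (le_lt_trans (ler_norm M))// ltrDl.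
Qed.

Lemma Cinf_pderiv_sqr_continuous f p x : Cinf f -> Om x ->
  {for x, continuous (fun w => enorm (pderiv p f w) ^+ 2)}.
Proof.
case=> f_smooth _ _ Omx; have [_ cf] := f_smooth p x Omx.
exact: (cvg_comp _ _ cf (@sqr_enorm_continuous R d _)).
Qed.

(** The norms only see [Om]; density and continuity carry the equality over to the closure. *)
Lemma Cinf_eq0_closure f g : Cinf f -> Cinf g ->
  (forall w, Om w -> f w = g w) -> {in closure Om, f =1 g}.
Proof.
move=> Cf Cg fg.
have [_ hc _] := Cinf_linear g f (-1) Cg Cf.
set h := (fun w => _) in hc.
have h0 w : Om w -> h w = 0 by move=> Omw; rewrite /h fg// scaleN1r addNr.
move=> w /set_mem clw; apply/eqP; rewrite -subr_eq0 addrC -scaleN1r -/(h w).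
apply: contrapT => /negP hw.
have nz_nbhs : nbhs (h w) (~` [set 0]).
  apply: open_nbhs_nbhs; split; last by apply/eqP.
  apply: closed_openC; apply: accessible_closed_set1.
  exact/hausdorff_accessible/norm_hausdorff.
have : within (closure Om) (nbhs w) (h @^-1` (~` [set 0])).
  by rewrite nbhs_subspace_in//; exact: hc w _ nz_nbhs.
move=> /clw[z [Omz hz]].
by apply: (hz (subset_closure Omz)); exact: h0.
Qed.

Lemma Cinf_pderivD f g p w : Cinf f -> Cinf g -> Om w ->
  pderiv p (f + g) w = pderiv p f w + pderiv p g w.
Proof.
move=> [f_smooth _ _] [g_smooth _ _] Omw.
have -> : f + g = (fun w => 1 *: f w + g w) by apply/funext => z; rewrite scale1r.
by rewrite (pderiv_linear _ _ _ Om Om_open)// scale1r.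
Qed.

(** Reduces scalar multiples to linear combinations without first placing the zero function in the
    space. *)
Lemma scale_as_linear f (a : R) : a *: f = (fun w => (a - 1) *: f w + f w).
Proof. by apply/funext => w; rewrite -[X in _ + X]scale1r -scalerDl subrK. Qed.

Lemma Cinf_pderivZ f p w (a : R) : Cinf f -> Om w ->
  pderiv p (a *: f) w = a *: pderiv p f w.
Proof.
move=> [f_smooth _ _] Omw.
rewrite scale_as_linear (pderiv_linear _ _ _ Om Om_open)//.
by rewrite -[X in _ + X]scale1r -scalerDl subrK.
Qed.

Lemma CinfZ f (a : R) : Cinf f -> Cinf (a *: f).
Proof. by move=> Cf; rewrite scale_as_linear; exact: Cinf_linear. Qed.

Lemma CinfD f g : Cinf f -> Cinf g -> Cinf (f + g).
Proof.
move=> Cf Cg.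
have -> : f + g = (fun w => 1 *: f w + g w) by apply/funext => z; rewrite scale1r.
exact: Cinf_linear.
Qed.

Section CkNorm.

Let multi_index_lt k p (i : 'I_n) : (morder p <= k)%N -> (p i < k.+1)%N.
Proof. by rewrite /morder (bigD1 i)//= ltnS; apply: leq_trans; exact: leq_addr. Qed.

(** Multi-indices of order at most [k] have entries at most [k], hence form a finite type; the sum
    of their bounds serves for all. *)
Lemma has_ubound_Ck k f : Cinf f -> has_ubound [set r : R | exists p w,
  [/\ (morder p <= k)%N, Om w & r = enorm (pderiv p f w)]].
Proof.
move=> Cf.
have /choice[M MP] (P : {ffun 'I_n -> 'I_k.+1}) : exists M, 0 <= M /\
    forall w, Om w -> enorm (pderiv (fun i => P i : nat) f w) ^+ 2 <= M.
  by have [M M0 hM] := Cinf_pderiv_bounded f (fun i => P i : nat) Cf; exists M.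
exists (Num.sqrt (\sum_P M P)) => _ [p [w [pk Omw ->]]].
pose P := [ffun i => Ordinal (multi_index_lt k p i pk)].
have -> : p = (fun i => P i : nat) by apply/funext => i; rewrite ffunE.
rewrite -[leLHS]ger0_norm ?enorm_ge0// -sqrtr_sqr; apply: ler_wsqrtr.
apply: (le_trans ((MP P).2 w Omw)); rewrite (bigD1 P)//= lerDl.
by apply: sumr_ge0 => Q _; exact: (MP Q).1.
Qed.

Lemma le_Ck_norm k f p w : Cinf f -> (morder p <= k)%N -> Om w ->
  enorm (pderiv p f w) <= Ck_norm Om k f.
Proof.
by move=> Cf pk Omw; apply: ub_le_sup; [exact: has_ubound_Ck|exists p, w].
Qed.

Lemma Ck_norm_le k f (B : R) : 0 <= B ->
  (forall p w, (morder p <= k)%N -> Om w -> enorm (pderiv p f w) <= B) ->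
  Ck_norm Om k f <= B.
Proof.
(* For empty [Om] the norm is the supremum of the empty set, which is 0 by convention. *)
move=> B0 hB; have [->|/set0P[w0 Omw0]] := eqVneq Om set0.
  rewrite /Ck_norm (_ : [set r | _] = set0) ?sup0//.
  by apply/seteqP; split=> // r [p [w []]].
apply: ge_sup => [|_ [p [w [pk Omw ->]]]]; last exact: hB.
by exists (enorm (pderiv (fun=> 0%N) f w0)), (fun=> 0%N), w0; rewrite /morder big1.
Qed.

Lemma Ck_norm_ge0 k f : 0 <= Ck_norm Om k f.
Proof.
rewrite /Ck_norm; set S := [set r | _].
have [S_sup|/sup_out ->//] := pselect (has_sup S).
have [r Sr] := S_sup.1; apply: (@le_trans _ _ r); last exact: sup_upper_bound.
by case: Sr => p [w [_ _ ->]]; exact: enorm_ge0.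
Qed.

Lemma Ck_normD k f g : Cinf f -> Cinf g ->
  Ck_norm Om k (f + g) <= Ck_norm Om k f + Ck_norm Om k g.
Proof.
move=> Cf Cg; apply: Ck_norm_le => [|p w pk Omw]; first by rewrite addr_ge0 ?Ck_norm_ge0.
rewrite Cinf_pderivD//; apply: le_trans (enormD _ _ _ _) _.
by apply: lerD; exact: le_Ck_norm.
Qed.

Lemma Ck_normZ k f (a : R) : Cinf f -> Ck_norm Om k (a *: f) = `|a| * Ck_norm Om k f.
Proof.
have le_scale b g : Cinf g -> Ck_norm Om k (b *: g) <= `|b| * Ck_norm Om k g.
  move=> Cg; apply: Ck_norm_le => [|p w pk Omw].
    by rewrite mulr_ge0 ?Ck_norm_ge0.
  by rewrite Cinf_pderivZ// enormZ ler_wpM2l//; exact: le_Ck_norm.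
move=> Cf; apply/le_anti; rewrite le_scale//=.
(* The reverse inequality is the first one for the factor [a^-1] and the function [a *: f]. *)
have [->|a0] := eqVneq a 0; first by rewrite normr0 mul0r Ck_norm_ge0.
have := le_scale a^-1 (a *: f) (CinfZ f a Cf).
by rewrite scalerA mulVf// scale1r normfV mulrC ler_pdivlMr ?normr_gt0// mulrC.
Qed.

Lemma Ck_norm_eq0 k f : Cinf f -> Ck_norm Om k f = 0 -> forall w, Om w -> f w = 0.
Proof.
move=> Cf f0 w Omw; apply/enorm0_eq0/le_anti; rewrite enorm_ge0 andbT -f0.
by rewrite -{1}(pderiv0 f); apply: le_Ck_norm => //; rewrite /morder big1.
Qed.

Lemma eq_Ck_norm k f g : (forall w, Om w -> f w = g w) ->
  Ck_norm Om k f = Ck_norm Om k g.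
Proof.
move=> fg; congr sup; apply/seteqP; split=> r [p [w [pk Omw ->]]]; exists p, w;
  by split=> //; rewrite (eq_pderiv _ _ _ Om Om_open p f g).
Qed.

End CkNorm.

Section HkNorm.

Let dens p f (w : 'rV[R]_n) : \bar R :=
  ((\1_Om w : R) * enorm (pderiv p f w) ^+ 2)%:E.

Let energy p f : R := fine (iter_int (dens p f)).

Let dens_ge0 p f w : (0 <= dens p f w)%E.
Proof. by rewrite lee_fin mulr_ge0// sqr_ge0. Qed.

Let dens_lsc p f : Cinf f -> seq_lsc (dens p f).
Proof.
move=> Cf; apply: indicator_seq_lsc => // [w|w Omw]; first exact: sqr_ge0.
exact: Cinf_pderiv_sqr_continuous.
Qed.

Let ball_lsc (c : 'rV[R]_n) (r M : R) : 0 <= M ->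
  seq_lsc (fun w => ((\1_(ball c r) w : R) * M)%:E).
Proof.
move=> M0; apply: (indicator_seq_lsc _ _ _ (fun=> M)) => // [|w _].
  exact: ball_open.
exact: cst_continuous.
Qed.

(** Comparison with a constant on a cube containing [Om]. Finiteness matters because [fine] sends an
    infinite integral to 0. *)
Let dens_fin_num p f : Cinf f -> iter_int (dens p f) \is a fin_num.
Proof.
move=> Cf; rewrite ge0_fin_numE; last exact: iter_int_ge0.
have [M M0 hM] := Cinf_pderiv_bounded f p Cf.
have [B [_ hB]] := compact_bounded Om_compact.
(* [hB] gives the bound [|B| + 1] on [Om]; one more unit makes the inequality strict for the open
   ball. *)
have r0 : 0 < `|B| + 2 by rewrite ltr_wpDl.
have Om_ball w : Om w -> ball (0 : 'rV[R]_n) (`|B| + 2) w.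
  move=> Omw; rewrite -ball_normE /= sub0r normrN.
  apply: (@le_lt_trans _ _ (`|B| + 1)); last by rewrite ltrD2l ltr1n.
  apply: (hB (`|B| + 1)); last exact: subset_closure.
  by rewrite (le_lt_trans (ler_norm B))// ltrDl.
apply: le_lt_trans (_ : ((M * ((`|B| + 2) *+ 2) ^+ n)%:E < +oo)%E); last exact: ltry.
rewrite -(iter_int_ball _ _ 0)//; apply: le_iter_int => //.
- exact: dens_lsc.
- by move=> w; rewrite lee_fin mulr_ge0.
- exact: ball_lsc.
- move=> w; rewrite lee_fin !indicE.
  have [Omw|nOmw] := pselect (Om w).
    by rewrite !mem_set ?mul1r//; [exact: hM|exact: Om_ball].
  by rewrite (memNset nOmw) mul0r mulr_ge0.
Qed.

Let energy_ge0 p f : 0 <= energy p f.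
Proof. by apply: fine_ge0; apply: iter_int_ge0. Qed.

Let sqr_scaled_continuous (b : R) p f x : Cinf f -> Om x ->
  {for x, continuous (fun w => b * enorm (pderiv p f w) ^+ 2)}.
Proof.
move=> Cf Omx; apply: (@continuousM _ _ (cst b)); first exact: cst_continuous.
exact: Cinf_pderiv_sqr_continuous.
Qed.

(** The weight [c] is the same for all multi-indices, so that the sum over them fits
    [sqrt_le_add]. *)
Let energyD p f g (c : R) : Cinf f -> Cinf g -> 0 < c ->
  energy p (f + g) <= (1 + c) * energy p f + (1 + c^-1) * energy p g.
Proof.
move=> Cf Cg c0.
have c1 : 0 <= 1 + c by rewrite addr_ge0// ltW.
have c2 : 0 <= 1 + c^-1 by rewrite addr_ge0// invr_ge0 ltW.
rewrite -lee_fin EFinD !EFinM !fineK ?dens_fin_num//; last exact: CinfD.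
have scal_ge0 (b : R) h w : 0 <= b -> (0 <= b%:E * dens p h w)%E.
  by move=> b0; rewrite mule_ge0.
have scal_lsc (b : R) h : 0 <= b -> Cinf h -> seq_lsc (fun w => b%:E * dens p h w)%E.
  move=> b0 Ch.
  have -> : (fun w => b%:E * dens p h w)%E =
      (fun w => ((\1_Om w : R) * (b * enorm (pderiv p h w) ^+ 2))%:E).
    by apply/funext => w; rewrite -EFinM mulrCA.
  apply: indicator_seq_lsc => // [w|w Omw]; first by rewrite mulr_ge0// sqr_ge0.
  exact: sqr_scaled_continuous.
rewrite -!iter_intZ//; try exact: dens_lsc.
rewrite -iter_intD//; try exact: scal_lsc; try by move=> w; exact: scal_ge0.
apply: le_iter_int => //.
- exact/dens_lsc/CinfD.
- by move=> w; rewrite adde_ge0//; exact: scal_ge0.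
- have -> : (fun w => (1 + c)%:E * dens p f w + (1 + c^-1)%:E * dens p g w)%E =
      (fun w => ((\1_Om w : R) * ((1 + c) * enorm (pderiv p f w) ^+ 2 +
         (1 + c^-1) * enorm (pderiv p g w) ^+ 2))%:E).
    by apply/funext => w; rewrite -!EFinM -EFinD mulrDr; congr (_ + _)%:E;
      rewrite mulrCA.
  apply: indicator_seq_lsc => // [w|w Omw].
    by rewrite addr_ge0// mulr_ge0// sqr_ge0.
  by apply: continuousD; exact: sqr_scaled_continuous.
- move=> w; rewrite -!EFinM -EFinD lee_fin indicE.
  have [Omw|nOmw] := pselect (Om w).
    by rewrite mem_set// !mul1r Cinf_pderivD//; exact: sqr_enormD_le.
  by rewrite (memNset nOmw) !mul0r !mulr0 addr0.
Qed.

Let energyZ p f (a : R) : Cinf f -> energy p (a *: f) = a ^+ 2 * energy p f.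
Proof.
move=> Cf; apply: EFin_inj; rewrite EFinM !fineK ?dens_fin_num//; last exact: CinfZ.
rewrite -iter_intZ ?sqr_ge0//; last exact: dens_lsc.
congr iter_int; apply/funext => w; rewrite -EFinM /dens indicE.
have [Omw|nOmw] := pselect (Om w).
  by rewrite mem_set// !mul1r Cinf_pderivZ// enormZ exprMn real_normK// num_real.
by rewrite (memNset nOmw) !mul0r mulr0.
Qed.

(** A nonzero value at [w] keeps the squared norm above [del] on a small cube inside [Om], which
    forces positive energy. *)
Let energy_eq0 f : Cinf f -> energy (fun=> 0%N) f = 0 -> forall w, Om w -> f w = 0.
Proof.
move=> Cf f0 w Omw; apply: enorm0_eq0; apply: contrapT => nfw.
have sq0 : 0 < enorm (f w) ^+ 2.
  by rewrite exprn_gt0// lt_neqAle enorm_ge0 andbT eq_sym; apply/eqP.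
pose del := enorm (f w) ^+ 2 / 2.
have del0 : 0 < del by rewrite divr_gt0.
have /nbhs_ballP[r /= r0 hr] : \forall z \near w, Om z /\ del < enorm (f z) ^+ 2.
  near=> z; split; first by near: z; exact: open_nbhs_nbhs.
  near: z; have := Cinf_pderiv_sqr_continuous f (fun=> 0%N) w Cf Omw.
  rewrite pderiv0 => /cvgr_gt; apply.
  by rewrite /del ltr_pdivrMr// ltr_pMr// ltr1n.
have : (iter_int (fun z => ((\1_(ball w r) z : R) * del)%:E) <=
    iter_int (dens (fun=> 0%N) f))%E.
  apply: le_iter_int => //.
  - by move=> z; rewrite lee_fin mulr_ge0// ltW.
  - by apply: ball_lsc; exact: ltW.
  - exact: dens_lsc.
  - move=> z; rewrite lee_fin pderiv0 !indicE.
    have [bz|nbz] := pselect (ball w r z).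
      by have [Omz /ltW] := hr z bz; rewrite !mem_set// !mul1r.
    by rewrite (memNset nbz) mul0r mulr_ge0// sqr_ge0.
rewrite iter_int_ball ?(ltW del0)// -[leRHS]fineK ?dens_fin_num// lee_fin.
rewrite -/(energy _ _) f0 leNgt => /negP; apply.
by rewrite mulr_gt0// exprn_gt0// pmulrn_rgt0.
Unshelve. all: by end_near. Qed.

Let Hk_normE k f : Hk_norm Om k f = Num.sqrt (\sum_(p : {ffun 'I_n -> 'I_k.+1} |
  (morder (fun i => nat_of_ord (p i)) <= k)%N) energy (fun i => nat_of_ord (p i)) f).
Proof. by []. Qed.

Lemma Hk_norm_ge0 k f : 0 <= Hk_norm Om k f.
Proof. exact: sqrtr_ge0. Qed.

Lemma Hk_normD k f g : Cinf f -> Cinf g ->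
  Hk_norm Om k (f + g) <= Hk_norm Om k f + Hk_norm Om k g.
Proof.
move=> Cf Cg; rewrite !Hk_normE; apply: sqrt_le_add => [||c c0].
- by apply: sumr_ge0 => p _; exact: energy_ge0.
- by apply: sumr_ge0 => p _; exact: energy_ge0.
rewrite !mulr_sumr -big_split /=; apply: ler_sum => p _; exact: energyD.
Qed.

Lemma Hk_normZ k f (a : R) : Cinf f -> Hk_norm Om k (a *: f) = `|a| * Hk_norm Om k f.
Proof.
move=> Cf; rewrite !Hk_normE -sqrtr_sqr -sqrtrM ?sqr_ge0// mulr_sumr.
by congr Num.sqrt; apply: eq_bigr => p _; exact: energyZ.
Qed.

Lemma Hk_norm_eq0 k f : Cinf f -> Hk_norm Om k f = 0 -> forall w, Om w -> f w = 0.
Proof.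
move=> Cf /eqP; rewrite Hk_normE sqrtr_eq0 => sum_le0.
apply: energy_eq0 => //; apply/le_anti; rewrite energy_ge0 andbT.
apply: le_trans sum_le0.
pose p0 : {ffun 'I_n -> 'I_k.+1} := [ffun=> ord0].
have p0E : (fun i => nat_of_ord (p0 i)) = (fun=> 0%N).
  by apply/funext => i; rewrite ffunE.
rewrite (bigD1 p0) /= ?p0E; last by rewrite /morder big1.
by rewrite lerDl; apply: sumr_ge0 => p _; exact: energy_ge0.
Qed.

Lemma eq_Hk_norm k f g : (forall w, Om w -> f w = g w) ->
  Hk_norm Om k f = Hk_norm Om k g.
Proof.
move=> fg; rewrite !Hk_normE; congr Num.sqrt; apply: eq_bigr => p _.
congr fine; congr iter_int; apply/funext => w; rewrite /dens indicE.
have [Omw|nOmw] := pselect (Om w).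
  by rewrite (eq_pderiv _ _ _ Om Om_open _ f g).
by rewrite (memNset nOmw) !mul0r.
Qed.

End HkNorm.

Lemma Ynorm_ge0 useH k f : 0 <= Ynorm useH Om k f.
Proof. by case: useH; [exact: Hk_norm_ge0|exact: Ck_norm_ge0]. Qed.

Lemma YnormD useH k f g : Cinf f -> Cinf g ->
  Ynorm useH Om k (f + g) <= Ynorm useH Om k f + Ynorm useH Om k g.
Proof. by case: useH; [exact: Hk_normD|exact: Ck_normD]. Qed.

Lemma YnormZ useH k f (a : R) : Cinf f ->
  Ynorm useH Om k (a *: f) = `|a| * Ynorm useH Om k f.
Proof. by case: useH; [exact: Hk_normZ|exact: Ck_normZ]. Qed.

Lemma Ynorm_eq0 useH k f : Cinf f -> Ynorm useH Om k f = 0 ->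
  forall w, Om w -> f w = 0.
Proof. by case: useH; [exact: Hk_norm_eq0|exact: Ck_norm_eq0]. Qed.

Lemma eq_Ynorm useH k f g : (forall w, Om w -> f w = g w) ->
  Ynorm useH Om k f = Ynorm useH Om k g.
Proof. by case: useH; [exact: eq_Hk_norm|exact: eq_Ck_norm]. Qed.

End FunctionSpace.

(** * Application to smooth functions on the closure of a domain *)

Theorem theorem1 (R : realType) (n d : nat) (Om : set 'rV[R]_n)
  (Om_open : open Om) (Om_int : interior (closure Om) = Om)
  (Om_compact : compact (closure Om)) (Om_bdry : smooth_boundary Om)
  (useH : bool)
  (X : lmodType R) (nX : nat -> X -> R) (X_frechet : graded_frechet nX)
  (F : X -> 'rV[R]_n -> 'rV[R]_d) (F_Y : forall x, Cinf_closure Om (F x))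
  (DF : X -> X -> 'rV[R]_n -> 'rV[R]_d) (L : X -> ('rV[R]_n -> 'rV[R]_d) -> X)
  (k0 : nat) (rad : R) (rad_gt0 : 0 < rad)
  (d1 d2 : nat) (m m' : nat -> R)
  (m_gt0 : forall k, 0 < m k) (m'_gt0 : forall k, 0 < m' k)
  (* (1) *)
  (H1 : {in closure Om, F 0 =1 (fun _ => 0)})
  (* (2) continuity of F : X -> Y *)
  (H2c : forall x, nX k0 x < rad ->
     forall k (e : R), 0 < e -> exists k' (del : R), 0 < del /\
       forall x', nX k' (x' - x) < del ->
         Ynorm useH Om k (fun w => F x' w - F x w) < e)
  (* (2) DF(x) is a linear map X -> Y *)
  (H2Y : forall x u, nX k0 x < rad -> Cinf_closure Om (DF x u))
  (H2lin : forall x, nX k0 x < rad -> forall (a : R) u v,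
     {in closure Om, DF x (a *: u + v) =1 (fun w => a *: DF x u w + DF x v w)})
  (* (2) Gateaux differentiability *)
  (H2G : forall x, nX k0 x < rad -> forall u k,
     (fun t : R => Ynorm useH Om k
        (fun w => t^-1 *: (F (x + t *: u) w - F x w) - DF x u w)) @ 0^' --> (0 : R))
  (* (3) *)
  (H3 : forall x, nX k0 x < rad -> forall u k,
     Ynorm useH Om k (DF x u) <= m k * nX (k + d1)%N u)
  (* (4) *)
  (H4 : forall x, nX k0 x < rad -> forall v, Cinf_closure Om v ->
     {in closure Om, DF x (L x v) =1 v})
  (* (5) *)
  (H5 : forall x, nX k0 x < rad -> forall v, Cinf_closure Om v -> forall k,
     nX k (L x v) <= m' k * Ynorm useH Om (k + d2)%N v) :
  forall y, Cinf_closure Om y ->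
    Ynorm useH Om (k0 + d2)%N y < rad / m' k0 ->
    forall mm : R, m' k0 < mm ->
      exists x : X, [/\ nX k0 x < rad,
                        nX k0 x <= mm * Ynorm useH Om (k0 + d2)%N y &
                        {in closure Om, F x =1 y}].
Proof.
move=> y Cy Ny_lt mm mm_gt.
pose N k (f : 'rV[R]_n -> 'rV[R]_d) := Ynorm useH Om k f.
(* [F 0] is known only on [closure Om]; there it agrees with [0 *: F 0], whose norm vanishes by
   homogeneity. *)
have F0N k : N k (F 0) = 0.
  have C0 : Cinf_closure Om (0 *: F 0) by exact: CinfZ.
  rewrite /N (eq_Ynorm _ _ _ Om Om_open useH k (F 0) (0 *: F 0)).
    by rewrite YnormZ// normr0 mul0r.
  move=> w Omw; rewrite H1 ?mem_set//; last exact: subset_closure.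
  by rewrite -[RHS]/(0 *: F 0 w) scale0r.
(* Without a margin, [y] vanishes on [Om] and [x = 0] is a solution. *)
have [Ny0|Ny0] := eqVneq (N (k0 + d2)%N y) 0.
  case: (X_frechet) => _ _ nX_scale _ _.
  have nX0 : nX k0 0 = 0 by rewrite -(scale0r 0) nX_scale normr0 mul0r.
  exists 0; rewrite nX0 -/(N _ _) Ny0 mulr0; split=> //.
  apply: Cinf_eq0_closure => // w Omw; rewrite H1 ?mem_set//; last exact: subset_closure.
  by rewrite (Ynorm_eq0 _ _ _ _ Om_open Om_compact useH _ y Cy Ny0).
have {}Ny0 : 0 < N (k0 + d2)%N y by rewrite lt_neqAle eq_sym Ny0 Ynorm_ge0.
have Nlim x v k : nX k0 x < rad -> Cinf_closure Om v ->
    (fun t : R => N k (t^-1 *: (F (x + t *: L x v) - F x) - v)) @ 0^' --> (0 : R).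
  move=> xrad Cv; have := H2G x xrad (L x v) k.
  have -> // : (fun t : R => Ynorm useH Om k (fun w =>
      t^-1 *: (F (x + t *: L x v) w - F x w) - DF x (L x v) w)) =
    (fun t : R => N k (t^-1 *: (F (x + t *: L x v) - F x) - v)).
  apply/funext => t; apply: eq_Ynorm => // w Omw.
  by rewrite H4// mem_set//; exact: subset_closure.
have [|||||x [xrad x_le xN]] := @right_inverse_local_surjectivity R X
    ('rV[R]_n -> 'rV[R]_d) nX (Cinf_closure Om) N X_frechet _ _ _ _ F L k0 d2 rad m'
    F_Y H2c _ m'_gt0 H5 y mm F0N Cy Ny0 Ny_lt mm_gt.
- by move=> a u v Cu Cv; exact: Cinf_linear.
- by move=> k v; exact: Ynorm_ge0.
- by move=> k u v Cu Cv; exact: YnormD.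
- by move=> k a v Cv; exact: YnormZ.
- by move=> x xrad v Cv k; exact: Nlim.
(* The norm of index 0 already determines the values on [Om]. *)
exists x; split=> //; apply: Cinf_eq0_closure => // w Omw.
have CFy : Cinf_closure Om (F x - y).
  by apply: CinfD => //; rewrite -scaleN1r; exact: CinfZ.
have := Ynorm_eq0 _ _ _ _ Om_open Om_compact useH 0%N _ CFy (xN 0%N) w Omw.
by move=> /eqP; rewrite subr_eq0 => /eqP.
Qed.
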